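(* Let $q$ be a prime power with $q>9$ if $q$ is odd and $q>2$ if $q$ is even, and let $k>1$ be an integer. If $U$ is an intersecting family of more than $q^k-q^{k-1}$ polynomials over $\mathbb{F}_q$ of degree at most $k$, then there exist $\alpha,\beta\in\mathbb{F}_q$ such that $g(\alpha)=\beta$ for all $g\in U$. Furthermore, there is a unique intersecting family of exactly $q^k$ polynomials over $\mathbb{F}_q$ of degree at most $k$ containing $U$.
   Context: The graph of a function $f\colon\mathbb{F}_q\to\mathbb{F}_q$ is $U_f=\{(x,f(x)):x\in\mathbb{F}_q\}$. A set of polynomials over $\mathbb{F}_q$ is intersecting if the graphs of any two of its members share at least one point. *)

(* Defs.v *)
From HB Require Import structures.
From mathcomp Require Import all_boot all_algebra qpoly.
Set Implicit Arguments. Unset Strict Implicit. Unset Printing Implicit Defensive.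
Import GRing.Theory.
Local Open Scope ring_scope.

(* A family of polynomials (of size at most n, i.e. degree < n) over a field F
   is intersecting if the graphs of any two members share a point,
   i.e. they agree at some x in F. *)
Definition intersecting (F : finFieldType) (n : nat) (U : {set {poly_n F}}) : Prop :=
  forall f g : {poly_n F}, f \in U -> g \in U ->
    exists x : F, (f : {poly F}).[x] = (g : {poly F}).[x].

(* Main.v *)
(** Induction on [k], slicing by the leading coefficient: some slice is a large
    family of degree less than [k], hence passes through a common point [P], and
    a polynomial missing [P] is disjoint from at least [q^(k-2)] members of the
    full slice through [P], which would make the slice too small.

    For [k = 2], let [d P] count the members of [U] (or of one slice of [U])
    through [P], let [v] be [d] minus its mean, and let [W f] be the sum of [v]
    over the graph of [f].  Quadratics interpolate three points, so the sums of
    [W^2] and [W^3] over all quadratics are [q^2] times those of [v^2] and [v^3]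
    over the points.  On [U] the function [W] is large because two members agree
    at two points unless they have the same leading coefficient or are tangent.
    Comparing the moments gives a point [P] with [d P] large, while a member of
    [U] missing [P] meets only about half of the quadratics through [P].
    For odd [q] tangencies are few on average, and [d] is taken over all of [U].
    For even [q] a slice of size [q] exists, each member of [U] has at most one
    tangent in it, and [d] is taken over that slice. *)

Require Import Defs.
From HB Require Import structures.
From mathcomp Require Import all_boot all_algebra qpoly.
From mathcomp Require Import all_order finfield ring lra zify.
Import Order.TTheory GRing.Theory Num.Theory.
Local Open Scope ring_scope.

(** * Counting by fibres, and Cauchy-Schwarz *)

Lemma sum_fibers (T Y : finType) (U : {set T}) (e : T -> Y) (phi : Y -> rat) :
  \sum_(f in U) phi (e f) =
  \sum_y #|[set f in U | e f == y]|%:R * phi y.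
Proof.
rewrite (partition_big e xpredT) //=; apply: eq_bigr => y _.
rewrite (eq_bigr (fun=> phi y)); last by move=> f /andP[_ /eqP->].
rewrite mulr_natl -sumr_const; apply: eq_bigl => f.
by rewrite inE.
Qed.

Lemma sum_sqr_fibers (T Y : finType) (U : {set T}) (e : T -> Y) :
  \sum_y #|[set f in U | e f == y]|%:R ^+ 2 =
  \sum_(f in U) \sum_(g in U) (e g == e f)%:R :> rat.
Proof.
under eq_bigr do rewrite expr2.
rewrite -sum_fibers; apply: eq_bigr => f _.
rewrite -sum1dep_card natr_sum big_mkcondr; apply: eq_bigr => g _.
by case: eqP.
Qed.

Lemma sqr_sum_le (Y : finType) (phi : Y -> rat) :
  (\sum_y phi y) ^+ 2 <= #|Y|%:R * \sum_y phi y ^+ 2.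
Proof.
set s := \sum_y phi y.
have [Y0|Y0] := posnP #|Y|.
  rewrite Y0 mul0r /s big_pred0 ?expr0n // => y.
  by have := card0_eq Y0 y.
have h : 0 <= \sum_y (#|Y|%:R * phi y - s) ^+ 2.
  by apply: sumr_ge0 => y _; apply: sqr_ge0.
have e : \sum_y (#|Y|%:R * phi y - s) ^+ 2 =
   #|Y|%:R * (#|Y|%:R * \sum_y phi y ^+ 2 - s ^+ 2).
  rewrite (eq_bigr (fun y => #|Y|%:R ^+ 2 * phi y ^+ 2
     + (- 2%:R * #|Y|%:R * s) * phi y + s ^+ 2)); last by move=> y _; ring.
  rewrite !big_split /= -!mulr_sumr -/s sumr_const -mulr_natl; ring.
have Y1 : 0 < #|Y|%:R :> rat by rewrite ltr0n.
by move: h; rewrite e pmulr_rge0 // subr_ge0.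
Qed.

(** * Quadratics *)

Section Quadratics.
Variable F : finFieldType.
Local Notation q := #|F|.
Local Notation quad := (F * F * F)%type.
Implicit Types (f g : quad) (U : {set quad}).

Definition qeval f x : F := f.1.1 * x ^+ 2 + f.1.2 * x + f.2.

Lemma card_quad : #|{: quad}| = (q ^ 3)%N.
Proof. by rewrite !card_prod !expnS expn0 muln1 mulnA. Qed.

Lemma sum_affine (b c : F) (phi : F -> rat) : b != 0 ->
  \sum_t phi (c + t * b) = \sum_y phi y.
Proof.
move=> b0; rewrite [RHS](reindex_inj (h := fun t => c + t * b)) //.
by move=> s t /addrI /(mulIf b0).
Qed.

Lemma sum_qeval x (phi : F -> rat) :
  \sum_f phi (qeval f x) = q%:R ^+ 2 * \sum_y phi y.
Proof.
rewrite -(pair_bigA _ (fun p c => phi (p.1 * x ^+ 2 + p.2 * x + c))) /=.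
rewrite (eq_bigr (fun=> \sum_y phi y)).
  by rewrite sumr_const card_prod -[LHS]mulr_natl natrM.
move=> p _; rewrite -(sum_affine 1 (p.1 * x ^+ 2 + p.2 * x)) ?oner_eq0 //.
by apply: eq_bigr => t _; rewrite mulr1.
Qed.

(* Adding [t (X - x1) (X - x2)] to [f] fixes its values at [x1] and [x2] and
   lets its value at [x] run through [F]. *)
Lemma sum_qeval_eq0 x1 x2 x (G : F -> F -> rat) (phi : F -> rat) :
    x != x1 -> x != x2 -> \sum_y phi y = 0 ->
  \sum_f G (qeval f x1) (qeval f x2) * phi (qeval f x) = 0.
Proof.
move=> xx1 xx2 phi0; set S := \sum_f _.
pose sh t f : quad := (f.1.1 + t, f.1.2 - t * (x1 + x2), f.2 + t * (x1 * x2)).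
have shI t : injective (sh t).
  move=> [[a b] c] [[a' b'] c'] [] /addIr -> /addIr -> /addIr -> //.
have shE t f z : qeval (sh t f) z = qeval f z + t * ((z - x1) * (z - x2)).
  by rewrite /qeval /sh /=; ring.
have qS : q%:R * S = 0.
  rewrite mulr_natl -sumr_const.
  rewrite (eq_bigr (fun t => \sum_f G (qeval f x1) (qeval f x2) *
     phi (qeval f x + t * ((x - x1) * (x - x2))))); last first.
    move=> t _; rewrite /S (reindex_inj (shI t)); apply: eq_bigr => f _.
    by rewrite !shE !subrr mul0r mulr0 !mulr0 !addr0.
  rewrite exchange_big big1 // => f _; rewrite -mulr_sumr sum_affine ?phi0 ?mulr0 //.
  by rewrite mulf_neq0 // subr_eq0.
move/eqP: qS; rewrite mulf_eq0 pnatr_eq0 => /orP[/eqP q0|/eqP//].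
by have := card_finRing_gt1 F; rewrite q0.
Qed.

(** * Second and third moments of a weight over all quadratics *)

Section Moments.
Variable v : F -> F -> rat.
Hypothesis v0 : forall x, \sum_y v x y = 0.

Definition weight f := \sum_x v x (qeval f x).

(** Cross terms at distinct points vanish by [sum_qeval_eq0], which leaves only the diagonal. *)
Lemma sum_weight_sqr :
  \sum_f weight f ^+ 2 = q%:R ^+ 2 * \sum_x \sum_y v x y ^+ 2.
Proof.
rewrite (eq_bigr (fun f => \sum_x \sum_x' v x (qeval f x) * v x' (qeval f x')));
  last first.
  move=> f _; rewrite expr2 /weight mulr_suml.
  by apply: eq_bigr => x _; rewrite mulr_sumr.
rewrite exchange_big mulr_sumr; apply: eq_bigr => x _.
rewrite exchange_big (bigD1 x) //= [X in _ + X]big1 ?addr0.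
  rewrite -(sum_qeval x (fun y => v x y ^+ 2)).
  by apply: eq_bigr => f _; rewrite expr2.
move=> x' xx'; exact: (sum_qeval_eq0 x x x' (fun y _ => v x y)).
Qed.

(** Unless the three points coincide, one of them occurs exactly once. Its factor sums to zero once
    the values at the other two are fixed, by [sum_qeval_eq0]. *)
Lemma sum_weight_cube :
  \sum_f weight f ^+ 3 = q%:R ^+ 2 * \sum_x \sum_y v x y ^+ 3.
Proof.
rewrite (eq_bigr (fun f => \sum_x \sum_x' \sum_x''
   v x (qeval f x) * v x' (qeval f x') * v x'' (qeval f x''))); last first.
  move=> f _; rewrite !exprS expr0 mulr1 mulrA /weight mulr_suml mulr_suml.
  apply: eq_bigr => x _; rewrite [v x _ * _]mulr_sumr mulr_suml.
  by apply: eq_bigr => x' _; rewrite mulr_sumr.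
rewrite exchange_big mulr_sumr; apply: eq_bigr => x _.
rewrite exchange_big (bigD1 x) //= [X in _ + X]big1 ?addr0; last first.
  move=> x' xx'; rewrite exchange_big big1 // => x'' _ /=.
  have [->|x''x] := eqVneq x'' x.
    rewrite (eq_bigr (fun f => (v x (qeval f x) * v x (qeval f x))
      * v x' (qeval f x'))); last by move=> f _; ring.
    exact: (sum_qeval_eq0 x x x' (fun y z => v x y * v x y)).
  have [->|x''x'] := eqVneq x'' x'.
    rewrite (eq_bigr (fun f => (v x' (qeval f x') * v x' (qeval f x'))
      * v x (qeval f x))); last by move=> f _; ring.
    by apply: (sum_qeval_eq0 x' x' x (fun y z => v x' y * v x' y)) => //;
      rewrite eq_sym.
  exact: (sum_qeval_eq0 x x' x'' (fun y z => v x y * v x' z)).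
rewrite exchange_big (bigD1 x) //= [X in _ + X]big1 ?addr0; last first.
  move=> x'' x''x; exact: (sum_qeval_eq0 x x x'' (fun y z => v x y * v x y)).
rewrite -(sum_qeval x (fun y => v x y ^+ 3)).
by apply: eq_bigr => f _; ring.
Qed.
End Moments.

(** * Point degrees and agreement counts of a family *)

Definition degree U x y := #|[set f in U | qeval f x == y]|.

Definition agree f g := #|[set x | qeval g x == qeval f x]|.

Definition meeting U := {in U &, forall f g, exists x, qeval f x = qeval g x}.

(** Each member meets a vertical line exactly once, so the subtracted term is the mean degree on
    that line. *)
Definition excess U x y : rat := (degree U x y)%:R - #|U|%:R / q%:R.

Lemma sum_degree U f :
  \sum_x (degree U x (qeval f x))%:R = \sum_(g in U) (agree f g)%:R :> rat.
Proof.
under eq_bigr do rewrite /degree -sum1dep_card natr_sum big_mkcondr.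
rewrite exchange_big; apply: eq_bigr => g _ /=.
by rewrite /agree -sum1dep_card natr_sum [RHS]big_mkcond.
Qed.

Lemma sum_degree_line U x : \sum_y (degree U x y)%:R = #|U|%:R :> rat.
Proof.
have /= := sum_fibers _ _ U (fun f => qeval f x) (fun=> 1).
rewrite sumr_const => ->; apply: eq_bigr => y _; exact: esym (mulr1 _).
Qed.

Lemma sum_degree_sqr U :
  \sum_x \sum_y (degree U x y)%:R ^+ 2 =
  \sum_(f in U) \sum_(g in U) (agree f g)%:R :> rat.
Proof.
rewrite (eq_bigr _ (fun x _ => sum_sqr_fibers _ _ U (fun f => qeval f x))).
rewrite exchange_big; apply: eq_bigr => f _; rewrite exchange_big.
apply: eq_bigr => g _; rewrite /agree -sum1dep_card natr_sum [RHS]big_mkcond /=.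
by apply: eq_bigr => x _; case: eqP.
Qed.

Lemma card_gt0_rat : 0 < q%:R :> rat.
Proof. by rewrite ltr0n; apply/card_gt0P; exists 0. Qed.

Lemma sum_excess U x : \sum_y excess U x y = 0.
Proof.
rewrite big_split /= sum_degree_line sumr_const -[X in _ + X]mulr_natl.
by rewrite mulrN mulrCA mulfV ?mulr1 ?subrr // gt_eqF ?card_gt0_rat.
Qed.

Lemma weight_excess U f :
  weight (excess U) f = \sum_(g in U) (agree f g)%:R - #|U|%:R.
Proof.
rewrite /weight big_split /= sum_degree sumr_const -[X in _ + X]mulr_natl.
by rewrite mulrN mulrCA mulfV ?mulr1 // gt_eqF ?card_gt0_rat.
Qed.

Lemma sum_excess_sqr U :
  \sum_x \sum_y excess U x y ^+ 2 =
  \sum_(f in U) \sum_(g in U) (agree f g)%:R - #|U|%:R ^+ 2.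
Proof.
have q0 := card_gt0_rat.
rewrite -sum_degree_sqr.
rewrite (eq_bigr (fun x => \sum_y (degree U x y)%:R ^+ 2 - #|U|%:R ^+ 2 / q%:R)).
  rewrite big_split /= sumr_const -[X in _ + X]mulr_natl.
  by rewrite mulrN mulrCA mulfV ?mulr1 // gt_eqF.
move=> x _; rewrite /excess.
rewrite (eq_bigr (fun y => (degree U x y)%:R ^+ 2
  + (- 2%:R * #|U|%:R / q%:R) * (degree U x y)%:R + #|U|%:R ^+ 2 / q%:R ^+ 2));
  last by move=> y _; field; rewrite gt_eqF.
rewrite !big_split /= -mulr_sumr sum_degree_line sumr_const -[X in _ + X]mulr_natl.
by field; rewrite gt_eqF.
Qed.

(** * Quadratics through a point missed by some member *)

Lemma double_card_imset (A : {set F}) (phi s : F -> F) :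
    {in A, forall x, s x \in A /\ phi (s x) = phi x} ->
  (2 * #|phi @: A| <= #|A| + #|[set x in A | s x == x]|)%N.
Proof.
move=> As.
have -> : (#|A| + #|[set x in A | s x == x]| = \sum_(x in A) (1 + (s x == x)))%N.
  rewrite big_split /= sum1_card; congr addn.
  rewrite -sum1dep_card big_mkcondr.
  by apply: eq_bigr => x _; case: eqP.
(* The fibre of [phi] through [x] also contains [s x]: it has two distinct elements or a fixed
   point, which counts twice. *)
rewrite (partition_big_imset phi) /= mulnC -sum_nat_const.
apply: leq_sum => _ /imsetP[x Ax ->]; have [Asx phis] := As x Ax.
rewrite (bigD1 x) /=; last by rewrite Ax eqxx.
have [|sx] := eqVneq (s x) x => //.
by rewrite (bigD1 (s x)) /= ?Asx ?phis ?eqxx ?sx.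
Qed.

(* The linear coefficient [u] of a quadratic [a (X - x0)^2 + u (X - x0) + y0]
   meeting [g] lies in the image of [z |-> - k / z - b z] on nonzero [z], and
   for [b != 0] this map is invariant under [z |-> k / (b z)]. *)
Lemma card_slice_through U g x0 y0 a :
    qeval g x0 != y0 ->
    {in U, forall f, [/\ f.1.1 = a, qeval f x0 = y0 &
                         exists x, qeval f x = qeval g x]} ->
  (#|U| < q)%N /\ (a != g.1.1 -> 2 * #|U| <= q.+1)%N.
Proof.
move=> gx0 Uf; set b := a - g.1.1; set k := y0 - qeval g x0.
have k0 : k != 0 by rewrite subr_eq0 eq_sym.
pose phi z := g.1.2 - b * (x0 + x0) + (- (k / z) - b * z).
pose A := [set~ (0 : F)].
have leU : (#|U| <= #|phi @: A|)%N.
  rewrite -(card_in_imset (D := U) (f := fun f => f.1.2)).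
    apply/subset_leq_card/subsetP => _ /imsetP[f Ufi ->].
    have [fa fx0 [x fx]] := Uf f Ufi.
    have xx0 : x - x0 != 0.
      rewrite subr_eq0; apply: contraNneq gx0 => xE.
      by rewrite -xE -fx xE fx0.
    apply/imsetP; exists (x - x0); first by rewrite !inE.
    apply: (mulIf xx0); move/eqP: fx; rewrite -subr_eq0 => /eqP fx.
    apply/eqP; rewrite -subr_eq0 -fx /phi /b /k -fx0 /qeval fa.
    by apply/eqP; field.
  move=> [[a1 b1] c1] [[a2 b2] c2] /Uf[/= a1E e1 _] /Uf[/= a2E e2 _] bE.
  by move: e1 e2; rewrite /qeval /= a1E a2E bE => <- /addrI ->.
have cA : #|A| = q.-1 by rewrite cardsC1.
have q0 : (0 < q)%N by apply/card_gt0P; exists 0.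
split; first by rewrite -(prednK q0) ltnS -cA (leq_trans leU) // leq_imset_card.
move=> ab; have b0 : b != 0 by rewrite subr_eq0.
pose s z := k / (b * z).
have sA : {in A, forall z, s z \in A /\ phi (s z) = phi z}.
  move=> z; rewrite !inE /s /phi => z0.
  rewrite mulf_neq0 ?invr_eq0 ?mulf_neq0 //.
  by split=> //; congr (_ + _); field; rewrite z0 b0 k0.
(* Fixed points of [s] are square roots of [k / b], so they are at most a pair of opposites. *)
have fix2 : (#|[set z in A | s z == z]| <= 2)%N.
  have sE z : z \in [set z in A | s z == z] -> z ^+ 2 = k / b.
    by rewrite !inE => /andP[z0 /eqP sz]; rewrite expr2 -{1}sz /s; field; rewrite b0.
  have [->|[z zs]] := set_0Vmem [set z in A | s z == z].
    by rewrite cards0.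
  apply: leq_trans (_ : #|[set z; - z]| <= _)%N; last by rewrite cards2; case: eqP.
  apply/subset_leq_card/subsetP => w ws; rewrite !inE -eqf_sqr.
  by rewrite (sE z) // (sE w).
have h := double_card_imset A phi s sA; rewrite cA in h.
apply: leq_trans (_ : 2 * #|phi @: A| <= _)%N; first by rewrite leq_pmul2l.
by apply: leq_trans h _; rewrite -[X in (_ <= X.+1)%N](prednK q0) -addn2 leq_add2l.
Qed.

Lemma sum_slices U (P : pred quad) :
  (#|[set f in U | P f]| = \sum_a #|[set f in U | P f & f.1.1 == a]|)%N.
Proof.
rewrite -sum1_card (partition_big (fun f => f.1.1) xpredT) //=.
apply: eq_bigr => a _; rewrite -sum1_card; apply: eq_bigl => f.
by rewrite !inE andbA.
Qed.

(** Slice by leading coefficient: the slice of [g] gives at most [q - 1] members through the point,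
    each of the other [q - 1] slices at most [(q + 1) / 2]. *)
Lemma double_degree_missed U g x0 y0 :
    meeting U -> g \in U -> qeval g x0 != y0 ->
  (2 * degree U x0 y0 + 3 <= q ^ 2 + 2 * q)%N.
Proof.
move=> mU gU gx0; have q1 := card_finRing_gt1 F.
have sl a := card_slice_through
  [set f in U | qeval f x0 == y0 & f.1.1 == a] g x0 y0 a gx0.
have {}sl a : (#|[set f in U | qeval f x0 == y0 & f.1.1 == a]| < q)%N /\
    (a != g.1.1 -> 2 * #|[set f in U | qeval f x0 == y0 & f.1.1 == a]| <= q.+1)%N.
  apply: sl => f; rewrite !inE => /and3P[fU /eqP fx0 /eqP fa]; split=> //.
  exact: mU.
rewrite /degree sum_slices (bigD1 g.1.1) //=; set r := (\sum_(a | _) _)%N.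
have [lt_g _] := sl g.1.1.
have le_r : (2 * r <= q.-1 * q.+1)%N.
  rewrite /r big_distrr /= -(cardC1 g.1.1) -sum_nat_const.
  by apply: leq_sum => a /(proj2 (sl a)).
move: lt_g le_r q1; rewrite -mulnn; clearbody r; move: #|[set f in U | _]| #|F| => m p.
by clear; case: p => // p; nia.
Qed.

Lemma agree_self f : agree f f = q.
Proof. by rewrite /agree (eq_card (B := F)) // => x; rewrite !inE eqxx. Qed.

Lemma sum_agree_ge0 U f : 0 <= \sum_(g in U) (agree f g)%:R :> rat.
Proof. by apply: sumr_ge0 => g _; apply: ler0n. Qed.

Lemma same_lead f g r : f != g -> f.1.1 = g.1.1 -> qeval f r = qeval g r ->
  f.1.2 != g.1.2 /\ forall x, qeval f x = qeval g x -> x = r.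
Proof.
case: f g => [[a b] c] [[a' b'] c']; rewrite /qeval /= => + aE; subst a'.
move=> neq er.
have bb : b - b' != 0.
  apply: contraNneq neq => /eqP; rewrite subr_eq0 => /eqP bE; subst b'.
  by move/addrI: er => ->.
split=> [|x ex]; first by rewrite -subr_eq0.
apply: (mulfI bb); apply/eqP; rewrite -subr_eq0.
have -> : (b - b') * x - (b - b') * r =
  (a * x ^+ 2 + b * x + c - (a * x ^+ 2 + b' * x + c')) -
  (a * r ^+ 2 + b * r + c - (a * r ^+ 2 + b' * r + c')) by ring.
by rewrite ex er !subrr.
Qed.

(** The witness is the second root of [f - g], given by Vieta; tangency is the case [s = r]. *)
Lemma diff_lead f g r : f.1.1 != g.1.1 -> qeval f r = qeval g r ->
  exists2 s, f.1.2 - g.1.2 = - (f.1.1 - g.1.1) * (r + s) &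
    forall x, qeval f x - qeval g x = (f.1.1 - g.1.1) * ((x - r) * (x - s)).
Proof.
rewrite -subr_eq0 => a0 er.
exists (- (f.1.2 - g.1.2) / (f.1.1 - g.1.1) - r); first by field.
move=> x; rewrite -[LHS]subr0 -(subrr (qeval g r)) -{1}er /qeval.
by field.
Qed.

(** Two members that also shared the linear coefficient would differ by a nonzero constant, so the
    linear coefficient is injective on a slice. *)
Lemma card_same_lead U a : meeting U -> (#|[set f in U | f.1.1 == a]| <= q)%N.
Proof.
move=> mU; rewrite -(card_in_imset (f := fun f => f.1.2)) ?max_card //.
move=> f g; rewrite !inE => /andP[fU /eqP fa] /andP[gU /eqP ga] /eqP bE.
apply/eqP; apply: contraTT bE => neq; have [r er] := mU f g fU gU.
by have [] := same_lead f g r neq _ er; rewrite ?fa ?ga.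
Qed.

(** * Odd [q]: controlling tangencies with nonsquares *)

Definition nonsquares := [set s : F | [forall z, z ^+ 2 != s]].

Local Notation nu := #|nonsquares|.

(** These linear functionals act as extra points: [merged] counts agreements on them as [agree] does
    on the points of the line. *)
Definition twist (p : F * F) f := qeval f p.1 - p.2 * f.1.1.

Definition merged f g :=
  #|[set p | (p.2 \in nonsquares) && (twist p g == twist p f)]|.

(* No functional [twist (x, s)] with [s] a nonsquare vanishes on
   [a (X - r)^2], so merged pairs agree at two points or share their leading
   coefficient. *)
Lemma merged_le U f g : meeting U -> f \in U -> g \in U ->
  (merged f g + nu <= nu * (agree f g + (f.1.1 == g.1.1)))%N.
Proof.
move=> mU fU gU; have [<-{g gU}|neq] := eqVneq f g.
  rewrite agree_self eqxx addn1 mulnS addnC leq_add2l /merged.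
  rewrite (eq_card (B := setX [set: F] nonsquares)).
    by rewrite cardsX cardsT mulnC.
  by move=> p; rewrite !inE eqxx andbT.
have [r er] := mU f g fU gU.
have twE p : (twist p g == twist p f) =
    (qeval f p.1 - qeval g p.1 == p.2 * (f.1.1 - g.1.1)).
  by rewrite eq_sym /twist -subr_eq0 -[RHS]subr_eq0; congr (_ == _); ring.
have agr : (0 < agree f g)%N by apply/card_gt0P; exists r; rewrite inE er.
case: (eqVneq f.1.1 g.1.1) => [aE|aN].
  rewrite addn1 mulnS addnC leq_add2l.
  apply: leq_trans (leq_pmulr _ agr); rewrite /merged.
  rewrite -(card_in_imset (f := fun p => p.2)).
    by apply/subset_leq_card/subsetP => _ /imsetP[p + ->]; rewrite inE => /andP[].
  have px p : qeval f p.1 - qeval g p.1 == p.2 * (f.1.1 - g.1.1) -> p.1 = r.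
    rewrite aE subrr mulr0 subr_eq0 => /eqP.
    by apply: (proj2 (same_lead f g r neq aE er)).
  move=> [x s] [x' s']; rewrite !inE !twE => /andP[_ /(px (x, s)) /= ->].
  by move=> /andP[_ /(px (x', s')) /= ->] ->.
have [s _ fgE] := diff_lead f g r aN er; rewrite addn0.
have a0 : f.1.1 - g.1.1 != 0 by rewrite subr_eq0.
have twE' p : (twist p g == twist p f) = ((p.1 - r) * (p.1 - s) == p.2).
  by rewrite twE fgE mulrC (inj_eq (mulIf a0)).
have nsq z : z ^+ 2 \notin nonsquares.
  by rewrite inE; apply/forallPn; exists z; rewrite eqxx.
have [rs|rs] := eqVneq r s.
  rewrite /merged eq_card0 ?leq_pmulr // => -[x t].
  rewrite !inE twE' /= -rs; apply/negP => /andP[+ /eqP tE].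
  by have := nsq (x - r); rewrite inE expr2 tE => /negP.
have agr2 : (2 <= agree f g)%N.
  apply: leq_trans (_ : #|[set r; s]| <= _)%N; first by rewrite cards2 rs.
  apply/subset_leq_card/subsetP => x xrs; rewrite inE eq_sym -subr_eq0 fgE.
  by case/set2P: xrs => ->; rewrite subrr ?mul0r ?mulr0.
apply: leq_trans (leq_mul (leqnn nu) agr2); rewrite muln2 -addnn leq_add2r.
(* If [(x - r) (x - s)] is a nonsquare, so is this ratio, since they differ by the factor
   [(x - s)^2]. The ratio determines [x], hence the pair, so at most [nu] functionals merge [f] and
   [g]. *)
pose h (p : F * F) := (p.1 - r) / (p.1 - s).
have xs p : p.2 \in nonsquares -> (p.1 - r) * (p.1 - s) = p.2 -> p.1 - s != 0.
  move=> pN pE; apply: contraTneq pN => p0; rewrite -pE p0 mulr0.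
  by rewrite -[0](expr0n _ 2) nsq.
rewrite /merged -(card_in_imset (f := h)).
  apply/subset_leq_card/subsetP => _ /imsetP[p + ->]; rewrite inE twE'.
  case/andP=> pN /eqP pE; have p0 := xs p pN pE.
  rewrite inE; apply/forallP => z; move: pN; rewrite inE => /forallP/(_ (z * (p.1 - s))).
  by apply: contra_neq; rewrite exprMn => ->; rewrite -pE /h; field.
move=> [x t] [x' t']; rewrite inE twE' => /andP[tN /eqP tE].
rewrite inE twE' => /andP[tN' /eqP tE'].
have := xs _ tN tE; have := xs _ tN' tE'; rewrite /h /= in tE tE' * => x'0 x0 hE.
suff xE : x = x' by rewrite -tE -tE' xE.
apply/eqP; rewrite -subr_eq0; have rs0 : r - s != 0 by rewrite subr_eq0.
have /eqP : (r - s) * (x - x') = 0; last by rewrite mulf_eq0 (negPf rs0).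
have -> : (r - s) * (x - x') = (x - s) * (x' - s) *
   ((x - r) / (x - s) - (x' - r) / (x' - s)) by field; rewrite x0 x'0.
by rewrite hE subrr mulr0.
Qed.

(** Each of the [q * nu] functionals splits [U] into [q] fibres, so by Cauchy-Schwarz it merges at
    least [#|U|^2 / q] pairs. Comparing with [merged_le] gives the bound; the error term comes from
    pairs with equal leading coefficient, at most [q] for each member. *)
Lemma sum_agree_ge U : meeting U -> (0 < nu)%N ->
  2%:R * #|U|%:R ^+ 2 <=
  \sum_(f in U) \sum_(g in U) (agree f g)%:R + q%:R * #|U|%:R :> rat.
Proof.
move=> mU nu0; have nu1 : 0 < nu%:R :> rat by rewrite ltr0n.
have q0 := card_gt0_rat.
have ge_merged : nu%:R * #|U|%:R ^+ 2 <=
    \sum_(f in U) \sum_(g in U) (merged f g)%:R :> rat.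
  have -> : \sum_(f in U) \sum_(g in U) (merged f g)%:R =
    \sum_(p in setX [set: F] nonsquares)
      \sum_y #|[set f in U | twist p f == y]|%:R ^+ 2 :> rat.
    rewrite (eq_bigr _ (fun p _ => sum_sqr_fibers _ _ U (twist p))).
    rewrite [RHS]exchange_big; apply: eq_bigr => f _; rewrite [RHS]exchange_big.
    apply: eq_bigr => g _; rewrite /merged -sum1dep_card natr_sum big_mkcondr.
    by apply: eq_big => [p|p _]; rewrite ?inE //; case: eqP.
  rewrite -(ler_pM2l q0) mulrA -natrM -[q](cardsT F) -cardsX -sumr_const.
  rewrite mulr_suml cardsT mulr_sumr; apply: ler_sum => p _; rewrite mul1r.
  apply: le_trans (sqr_sum_le _ _).
  have := sum_fibers _ _ U (twist p) (fun=> 1); rewrite sumr_const => ->.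
  by under eq_bigr do rewrite mulr1.
have le_merged : \sum_(f in U) \sum_(g in U) ((merged f g)%:R + nu%:R) <=
   nu%:R * (\sum_(f in U) \sum_(g in U) (agree f g)%:R + q%:R * #|U|%:R) :> rat.
  have -> : \sum_(f in U) \sum_(g in U) (agree f g)%:R + q%:R * #|U|%:R =
      \sum_(f in U) (\sum_(g in U) (agree f g)%:R + q%:R) :> rat.
    by rewrite big_split /= sumr_const mulr_natr.
  rewrite mulr_sumr; apply: ler_sum => f fU.
  apply: le_trans (_ : \sum_(g in U) nu%:R * ((agree f g)%:R + (f.1.1 == g.1.1)%:R) <= _).
    apply: ler_sum => g gU; rewrite -!natrD -natrM ler_nat.
    exact: merged_le gU.
  rewrite -mulr_sumr ler_pM2l // big_split /= lerD2l.
  rewrite -natr_sum ler_nat; apply: leq_trans (card_same_lead U f.1.1 mU).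
  rewrite -sum1dep_card big_mkcondr; apply: leq_sum => g _.
  by rewrite eq_sym; case: eqP.
rewrite -(ler_pM2l nu1); apply: le_trans le_merged.
under eq_bigr do rewrite big_split /= sumr_const.
rewrite big_split /= sumr_const -mulrnA.
apply: le_trans (lerD ge_merged (lexx _)).
rewrite -[X in _ + X]mulr_natr natrM; set n := #|U|%:R.
by have -> : nu%:R * (2%:R * n ^+ 2) = nu%:R * n ^+ 2 + nu%:R * (n * n) by ring.
Qed.

Lemma meeting_star U x y : meeting U -> (q ^ 2 + 2 * q < 2 * degree U x y + 3)%N ->
  {in U, forall f, qeval f x = y}.
Proof.
move=> mU big f fU; apply/eqP; apply: contraLR big => fx.
by rewrite -leqNgt (double_degree_missed U f).
Qed.

Lemma meeting_star_nonsquare U : meeting U -> (0 < nu)%N -> (10 < q)%N ->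
  (q ^ 2 - q < #|U|)%N -> exists x y, {in U, forall f, qeval f x = y}.
Proof.
move=> mU nu0 q11 Ubig.
have [/existsP[x /existsP[y big]]|small] :=
  boolP [exists x, exists y, q ^ 2 + 2 * q < 2 * degree U x y + 3]%N.
  by exists x, y; apply: meeting_star.
exfalso; set D := \sum_(f in U) \sum_(g in U) (agree f g)%:R : rat.
set n := #|U|%:R : rat; set p := q%:R : rat.
have p11 : 11%:R <= p by rewrite ler_nat.
have n_gt : p ^+ 2 - p + 1 <= n.
  have : (q ^ 2 + 1 <= #|U| + q)%N by lia.
  by rewrite -(ler_nat rat) !natrD natrX -/p -/n; lra.
have D_ge : 2%:R * n ^+ 2 <= D + p * n := sum_agree_ge U mU nu0.
pose Q := D - n ^+ 2; pose w := Q / n.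
have QE : \sum_x \sum_y excess U x y ^+ 2 = Q := sum_excess_sqr U.
have n0 : 0 < n by nra.
have QwE : Q = w * n by rewrite /w divfK ?gt_eqF.
have w_ge : n - p <= w by rewrite /w ler_pdivlMr // /Q; nra.
(* The largest excess allowed when no point has degree above the threshold of
   [double_degree_missed]. *)
pose mu := (p ^+ 2 + 2%:R * p - 3%:R) / 2%:R - n / p.
have le_mu x y : excess U x y <= mu.
  rewrite /excess lerD2r ler_pdivlMr //.
  move/existsPn/(_ x)/existsPn/(_ y): small; rewrite -leqNgt.
  by rewrite -(ler_nat rat) !natrD !natrM -/p; lra.
have cube : \sum_x \sum_y excess U x y ^+ 3 <= mu * Q.
  rewrite -QE mulr_sumr; apply: ler_sum => x _; rewrite mulr_sumr.
  by apply: ler_sum => y _; rewrite exprS ler_wpM2r ?sqr_ge0.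
pose W := weight (excess U).
have WE f : W f = \sum_(g in U) (agree f g)%:R - n := weight_excess U f.
have sumW : \sum_(f in U) W f = Q.
  by rewrite (eq_bigr _ (fun f _ => WE f)) big_split /= sumr_const -mulr_natr mulNr -expr2.
have W_ge f : 0 <= W f + n by rewrite WE subrK sum_agree_ge0.
have W_ge0 f : f \in U -> 0 <= W f.
  move=> fU; rewrite WE subr_ge0 /n -sumr_const; apply: ler_sum => g gU.
  rewrite ler1n; apply/card_gt0P; have [x fg] := mU f g fU gU.
  by exists x; rewrite inE fg.
have above : \sum_f (W f + n) * W f ^+ 2 <= p ^+ 2 * (mu + n) * Q.
  rewrite (eq_bigr (fun f => W f ^+ 3 + n * W f ^+ 2)); last by move=> f _; ring.
  rewrite big_split /= -mulr_sumr sum_weight_cube ?sum_weight_sqr;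
    try exact: sum_excess.
  by rewrite QE -/p; nra.
(* Jensen: the tangent at [w] lies below [(t + n) t^2] for [t >= 0]. *)
have below : Q * (w * (w + n)) <= \sum_f (W f + n) * W f ^+ 2.
  apply: le_trans (_ : \sum_(f in U) (W f + n) * W f ^+ 2 <= _); last first.
    rewrite [leRHS](bigID (mem U)) /= lerDl; apply: sumr_ge0 => f _.
    by rewrite mulr_ge0 ?sqr_ge0.
  apply: le_trans (_ : \sum_(f in U) (w ^+ 2 * (w + n) +
     (3%:R * w ^+ 2 + 2%:R * n * w) * (W f - w)) <= _); last first.
    apply: ler_sum => f /W_ge0 Wf; rewrite -subr_ge0.
    have -> : (W f + n) * W f ^+ 2 - (w ^+ 2 * (w + n) +
       (3%:R * w ^+ 2 + 2%:R * n * w) * (W f - w)) =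
       (W f - w) ^+ 2 * (W f + 2%:R * w + n) by ring.
    by rewrite mulr_ge0 ?sqr_ge0 //; nra.
  have sumWw : \sum_(f in U) (W f - w) = 0.
    by rewrite sumrB sumW sumr_const -[w *+ _]mulr_natr; apply/eqP; rewrite subr_eq0 QwE.
  rewrite big_split /= sumr_const -mulr_sumr sumWw mulr0 addr0 -[leRHS]mulr_natr.
  by rewrite QwE -/n; lra.
clear -p11 n_gt D_ge n0 QwE w_ge above below.
have w0 : 0 < w by nra.
have Q0 : 0 < Q by rewrite QwE mulr_gt0.
have := le_trans below above; rewrite [leRHS]mulrC ler_pM2l // => le1.
have le2 : (n - p) * (2%:R * n - p) <= w * (w + n).
  by apply: ler_pM => //; nra.
have muE : p ^+ 2 * (mu + n) =
   p ^+ 2 * ((p ^+ 2 + 2%:R * p - 3%:R) / 2%:R + n) - n * p.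
  by rewrite /mu; field; rewrite gt_eqF //; lra.
have := le_trans le2 le1; rewrite muE => le3.
have : n * (2%:R * n - 2%:R * p - p ^+ 2) <=
       p ^+ 2 * (p ^+ 2 + 2%:R * p - 5%:R) / 2%:R by nra.
have : (p ^+ 2 - p + 1) * (p ^+ 2 - 4%:R * p + 2%:R) <=
   n * (2%:R * n - 2%:R * p - p ^+ 2) by apply: ler_pM => //; nra.
have : p ^+ 2 * (p ^+ 2 + 2%:R * p - 5%:R) / 2%:R <
   (p ^+ 2 - p + 1) * (p ^+ 2 - 4%:R * p + 2%:R).
  (* Expanded in [t], the difference of the two sides has only positive coefficients. *)
  have [t t0 ->] : exists2 t : rat, 0 <= t & p = t + 11%:R.
    by exists (p - 11%:R); lra.
  by nra.
lra.
Qed.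

(** * Even [q]: moments over a full slice *)

Lemma sum_weight (v : F -> F -> rat) : (forall x, \sum_y v x y = 0) ->
  \sum_f weight v f = 0.
Proof.
move=> v0; rewrite exchange_big big1 // => x _.
by rewrite (sum_qeval x (v x)) v0 mulr0.
Qed.

Lemma exists_full_slice U : (q ^ 2 - q < #|U|)%N ->
  exists a, (q <= #|[set f in U | f.1.1 == a]|)%N.
Proof.
move=> Ubig; apply/existsP; apply: contraLR Ubig => /existsPn small.
have -> : (#|U| = \sum_a #|[set f in U | f.1.1 == a]|)%N.
  have := sum_slices U predT; rewrite -[[set f in U | predT f]](_ : U = _) //.
  by apply/setP => f; rewrite inE andbT.
rewrite -leqNgt; apply: leq_trans (_ : \sum_(a : F) q.-1 <= _)%N.
  by apply: leq_sum => a _; have := small a; rewrite -ltnNge; case: q => // m.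
by rewrite sum_nat_const -subn1 mulnBr muln1 mulnn.
Qed.

Lemma agree_same_lead f g r : f != g -> f.1.1 = g.1.1 -> qeval f r = qeval g r ->
  agree f g = 1%N.
Proof.
move=> neq aE er; have [_ fr] := same_lead f g r neq aE er.
rewrite /agree (_ : [set x | _] = [set r]) ?cards1 //; apply/setP => x.
rewrite !inE; apply/eqP/eqP => [/esym/fr //|->]; exact: esym.
Qed.

Section Char2.
Hypothesis char2 : 2%:R = 0 :> F.
Variables (U : {set quad}) (a : F).
Hypothesis mU : meeting U.
Let V := [set f in U | f.1.1 == a].
Hypothesis cV : #|V| = q.

Let VU f : f \in V -> f \in U.
Proof. by rewrite inE => /andP[]. Qed.

Lemma sum_agree_slice : \sum_(f in V) \sum_(g in V) (agree f g)%:R =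
  q%:R * (2%:R * q%:R - 1) :> rat.
Proof.
rewrite (eq_bigr (fun=> 2%:R * q%:R - 1)).
  by rewrite sumr_const cV -[LHS]mulr_natl.
move=> f fV; rewrite (bigD1 f) //= agree_self.
rewrite (eq_bigr (fun=> 1)); last first.
  move=> g /andP[gV gf]; move: fV gV; rewrite !inE.
  move=> /andP[fU /eqP fa] /andP[gU /eqP ga]; have [r er] := mU f g fU gU.
  by rewrite (agree_same_lead f g r) 1?eq_sym // fa ga.
have : \sum_(i in V) (1 : rat) = q%:R by rewrite sumr_const cV.
by rewrite (bigD1 f) //= => <-; ring.
Qed.

(** In characteristic 2 a double root of [g - f] forces equal linear coefficients. These are
    distinct within [V], so a [g] outside [V] is tangent to at most one member of [V] and agrees at
    two points with each of the others. *)
Lemma sum_agree_full_slice g : g \in U ->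
  (2 * q <= \sum_(f in V) agree g f + 1)%N.
Proof.
move=> gU; have [gV|gV] := boolP (g \in V).
  rewrite (bigD1 g) //= agree_self.
  have : (q <= 1 + \sum_(f in V | f != g) agree g f)%N.
    rewrite -{1}cV -sum1_card (bigD1 g) //= leq_add2l; apply: leq_sum => f.
    case/andP => fV fg; apply/card_gt0P.
    have [r er] := mU g f gU (VU f fV).
    by exists r; rewrite inE er.
  by rewrite mul2n -addnn -addnA leq_add2l [X in _ -> (_ <= X)%N]addnC.
have le1 : (\sum_(f in V) (f.1.2 == g.1.2) <= 1)%N.
  have [/existsP[f /andP[fV /eqP fg]]|none] := boolP [exists f in V, f.1.2 == g.1.2].
    rewrite (bigD1 f) //= fg eqxx big1 // => h /andP[hV hf].
    move: fV hV; rewrite !inE => /andP[fU /eqP fa] /andP[hU /eqP ha].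
    have [r er] := mU h f hU fU.
    have [] := same_lead h f r hf _ er; first by rewrite ha fa.
    by rewrite fg => /negPf ->.
  rewrite big1 // => f fV; move/existsPn/(_ f): none; rewrite fV.
  by case: eqP.
apply: leq_trans (leq_add (leqnn _) le1); rewrite -big_split /= mulnC -{1}cV.
rewrite -sum_nat_const; apply: leq_sum => f fV.
have fU := VU f fV.
have aN : g.1.1 != f.1.1.
  by move: fV gV; rewrite !inE fU gU /= => /eqP ->.
have [r er] := mU g f gU fU; have [s bE fgE] := diff_lead g f r aN er.
have [rs|rs] := eqVneq r s.
  move/eqP: bE; rewrite -rs -mulr2n -[r *+ 2]mulr_natl char2 mul0r mulr0.
  rewrite subr_eq0 => /eqP ->; rewrite eqxx addn1 ltnS.
  by apply/card_gt0P; exists r; rewrite inE er.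
apply: leq_trans (leq_addr _ _).
apply: leq_trans (_ : #|[set r; s]| <= _)%N; first by rewrite cards2 rs.
apply/subset_leq_card/subsetP => x xrs; rewrite inE eq_sym -subr_eq0 fgE.
by case/set2P: xrs => ->; rewrite subrr ?mul0r ?mulr0.
Qed.

(* Integrality of [v] gives [v (v + 1) >= 0], hence the cubic bound
   [v^3 <= (q - 4) v^2 + (q - 3) v] when [v <= q - 3]; on the other side
   [(W + 1)^2 (W + q)] is nonnegative everywhere and large on [U]. *)
Lemma full_slice_degree : (3 < q)%N -> (q ^ 2 - q < #|U|)%N ->
  exists x y, (q <= degree V x y + 1)%N.
Proof.
move=> q4 Ubig.
have [/existsP[x /existsP[y big]]|small] :=
  boolP [exists x, exists y, q <= degree V x y + 1]%N; first by exists x, y.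
exfalso; set n := #|U|%:R : rat; set p := q%:R : rat.
have p4 : 4%:R <= p by rewrite ler_nat.
have n_gt : p ^+ 2 - p + 1 <= n.
  have : (q ^ 2 + 1 <= #|U| + q)%N by lia.
  by rewrite -(ler_nat rat) !natrD natrX -/p -/n; lra.
pose v := excess V.
have vE x y : v x y = (degree V x y)%:R - 1.
  by rewrite /v /excess cV mulfV // gt_eqF ?card_gt0_rat.
have sum_sqr : \sum_x \sum_y v x y ^+ 2 = p ^+ 2 - p.
  rewrite sum_excess_sqr sum_agree_slice cV -/p; ring.
have le_v x y : v x y <= p - 3%:R.
  rewrite vE; move/existsPn/(_ x)/existsPn/(_ y): small; rewrite -ltnNge => lt.
  have : (degree V x y + 2 <= q)%N by lia.
  by rewrite -(ler_nat rat) natrD -/p; lra.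
have v1 x y : 0 <= v x y * (v x y + 1).
  rewrite vE subrK; case: (degree V x y) => [|d]; first by rewrite mulr0.
  by rewrite mulr_ge0 ?ler0n // subr_ge0 ler1n.
have cube : \sum_x \sum_y v x y ^+ 3 <= (p - 4%:R) * (p ^+ 2 - p).
  rewrite -sum_sqr mulr_sumr; apply: ler_sum => x _.
  have -> : (p - 4%:R) * \sum_y v x y ^+ 2 =
      \sum_y ((p - 4%:R) * v x y ^+ 2 + (p - 3%:R) * v x y).
    by rewrite big_split /= -!mulr_sumr sum_excess mulr0 addr0.
  apply: ler_sum => y _; rewrite -subr_ge0.
  have -> : (p - 4%:R) * v x y ^+ 2 + (p - 3%:R) * v x y - v x y ^+ 3 =
     v x y * (v x y + 1) * (p - 3%:R - v x y) by ring.
  by rewrite mulr_ge0 ?v1 ?subr_ge0.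
pose W := weight v.
have WE f : W f = \sum_(g in V) (agree f g)%:R - p.
  by rewrite /W weight_excess cV.
have above : \sum_f (W f + 1) ^+ 2 * (W f + p) <=
    p ^+ 2 * ((p - 4%:R) * (p ^+ 2 - p)) + (p + 2%:R) * (p ^+ 2 * (p ^+ 2 - p))
    + p ^+ 4.
  rewrite (eq_bigr (fun f => W f ^+ 3 + (p + 2%:R) * W f ^+ 2
     + (2%:R * p + 1) * W f + p)); last by move=> f _; ring.
  rewrite !big_split /= -!mulr_sumr sum_weight; last exact: sum_excess.
  rewrite sum_weight_cube ?sum_weight_sqr; try exact: sum_excess.
  rewrite sum_sqr sumr_const card_quad -/p mulr0 addr0 -[p *+ _]mulr_natr natrX -/p.
  by rewrite -exprS lerD2r lerD2r ler_wpM2l // sqr_ge0.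
have below : n * (p ^+ 2 * (2%:R * p - 1)) <= \sum_f (W f + 1) ^+ 2 * (W f + p).
  apply: le_trans (_ : \sum_(f in U) (W f + 1) ^+ 2 * (W f + p) <= _); last first.
    rewrite [leRHS](bigID (mem U)) /= lerDl; apply: sumr_ge0 => f _.
    by rewrite mulr_ge0 ?sqr_ge0 // WE subrK sum_agree_ge0.
  rewrite [leLHS]mulr_natl -sumr_const; apply: ler_sum => f fU.
  have Wf : p - 1 <= W f.
    have := sum_agree_full_slice f fU.
    rewrite -(ler_nat rat) natrD natrM natr_sum -/p WE; lra.
  have p0 : 0 <= p by lra.
  apply: ler_pM; rewrite ?sqr_ge0 //; try lra.
  by rewrite lerXn2r ?nnegrE; lra.
have le1 := le_trans below above.
have c0 : 0 <= p ^+ 2 * (2%:R * p - 1) by rewrite mulr_ge0 ?sqr_ge0 //; lra.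
(* At the least admissible [n] the lower bound exceeds the upper one by exactly [p^2 (p - 1)]. *)
have le2 := ler_wpM2r c0 n_gt.
have lt3 : 0 < p ^+ 2 * (p - 1) by rewrite mulr_gt0 ?exprn_gt0 //; lra.
clear -le1 le2 lt3; lra.
Qed.

(** Some point lies on at least [q - 1] members of [V]. A member of [U] missing it with leading
    coefficient other than [a] would force [2 (q - 1) <= q + 1]. Hence only members of [V] can miss
    it, at most one does, and [meeting_star] excludes that one too. *)
Lemma meeting_star_char2 : (3 < q)%N -> (q ^ 2 - q < #|U|)%N ->
  exists x y, {in U, forall f, qeval f x = y}.
Proof.
move=> q4 Ubig; have [x [y big]] := full_slice_degree q4 Ubig.
exists x, y; apply: meeting_star => //.
have thr f : f \in U -> qeval f x != y -> f.1.1 = a.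
  move=> fU fx; apply/eqP; apply: contraLR q4; rewrite eq_sym -leqNgt => fa.
  have [||_ /(_ fa)] := card_slice_through [set g in V | qeval g x == y] f x y a.
  - exact: fx.
  - move=> g; rewrite !inE => /andP[/andP[gU /eqP ga] /eqP gx]; split=> //.
    exact: mU.
  by move: big; rewrite /degree; lia.
have : (#|U| <= degree U x y + 1)%N.
  rewrite -(cardsID [set f | qeval f x == y] U) leq_add //.
    by apply/subset_leq_card/subsetP => f; rewrite !inE.
  have le : (#|U :\: [set f | qeval f x == y]| <= #|V :\: [set f | qeval f x == y]|)%N.
    apply/subset_leq_card/subsetP => f; rewrite !inE => /andP[fx fU].
    by rewrite fx fU (thr f) ?eqxx.
  apply: leq_trans le _; have := cardsID [set f | qeval f x == y] V.
  rewrite cV (_ : V :&: _ = [set f in V | qeval f x == y]) => [c|].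
    by rewrite -(leq_add2l (degree V x y)) {1}/degree c.
  by apply/setP => f; rewrite !inE.
by move: Ubig q4; move: #|U| (degree U x y) #|F|; clear; nia.
Qed.
End Char2.

(** * Parity of [q], and both cases combined *)

Lemma char2_even : (2%:R == 0 :> F) = ~~ odd q.
Proof.
have [p p_pr pF] := finPcharP F.
have qE : q = (p ^ logn p q)%N := card_pprimeChar pF.
have n0 : logn p q != 0%N.
  by apply: contraTneq (card_finRing_gt1 F) => n0; rewrite qE n0.
rewrite -(dvdn_pcharf pF) dvdn_prime2 // qE oddX (negPf n0) /=.
by have [->//|op] := even_prime p_pr; rewrite op; apply: contraTF op => /eqP ->.
Qed.

(** Otherwise squaring is onto, hence injective on a finite field, and [1 = -1]. *)
Lemma nonsquares_gt0 : odd q -> (0 < nu)%N.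
Proof.
move=> oq; rewrite card_gt0; apply/set0Pn.
have [/existsP[s sN]|none] := boolP [exists s, s \in nonsquares]; first by exists s.
have sur s : exists z : F, z ^+ 2 == s.
  by move/existsPn/(_ s): none; rewrite inE negb_forall => /existsP[z];
    rewrite negbK; exists z.
pose h s := xchoose (sur s).
have hK s : h s ^+ 2 = s := eqP (xchooseP (sur s)).
have hI : injective h by apply: (can_inj (g := fun z => z ^+ 2)).
have [g hg gh] := injF_bij hI.
have gE z : g z = z ^+ 2 by rewrite -{2}[z]gh hK.
have : (1 : F) = -1.
  by apply: (can_inj gh); rewrite !gE sqrrN.
move/eqP; rewrite -subr_eq0 opprK => two; exfalso.
by have := char2_even; rewrite oq /= -mulr2n in two *; rewrite two.
Qed.

Lemma quad_star U : meeting U -> (odd q -> (9 < q)%N) -> (~~ odd q -> (2 < q)%N) ->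
    (q ^ 2 - q < #|U|)%N ->
  exists x y, {in U, forall f, qeval f x = y}.
Proof.
move=> mU hodd heven Ubig; have [oq|eq] := boolP (odd q).
  apply: meeting_star_nonsquare => //; first exact: nonsquares_gt0.
  (* The moment argument needs [q >= 11]; [q = 10] is excluded by parity. *)
  by have := hodd oq; rewrite leq_eqVlt => /orP[/eqP q10|//]; rewrite -q10 in oq.
have [a Va] := exists_full_slice U Ubig.
apply: (meeting_star_char2 _ U a) => //.
- by apply/eqP; rewrite char2_even.
- by apply/eqP; rewrite eqn_leq Va card_same_lead.
by have := heven eq; rewrite leq_eqVlt => /orP[/eqP q3|//]; rewrite -q3 in eq.
Qed.
End Quadratics.

(** * Polynomials of bounded degree *)

Section Polynomials.
Variable F : finFieldType.
Local Notation q := #|F|.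

(** Used as an injection into a type of size [q^m], on families where these [m] coefficients
    determine the remaining ones. *)
Definition tail_npoly (n m j : nat) (f : {poly_n F}) : {poly_m F} :=
  mk_npoly m (fun i => (f : {poly F})`_(i + j)).

Lemma tail_npoly_coef n m j (f g : {poly_n F}) i :
  tail_npoly n m j f = tail_npoly n m j g -> (j <= i < m + j)%N ->
  (f : {poly F})`_i = (g : {poly F})`_i.
Proof.
move=> /(congr1 (fun h : {poly_m F} => (h : {poly F})`_(i - j))) /= + /andP[ji im].
by rewrite !coef_poly ltn_subLR // addnC im subnK.
Qed.

Definition star n (alpha beta : F) : {set {poly_n F}} :=
  [set f : {poly_n F} | (f : {poly F}).[alpha] == beta].

Lemma card_star k alpha beta : #|star k.+1 alpha beta| = (q ^ k)%N.
Proof.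
apply/eqP; rewrite eqn_leq -card_npoly; apply/andP; split.
  rewrite -(card_in_imset (f := tail_npoly k.+1 k 1)) ?max_card // => f g.
  rewrite !inE => /eqP fa /eqP ga fg; apply/val_inj => /=.
  have fgE : (f : {poly F}) - g = ((f : {poly F})`_0 - (g : {poly F})`_0)%:P.
    apply/polyP => -[|i]; rewrite coefB coefC //=.
    have [ik|ki] := ltnP i k.
      by rewrite (tail_npoly_coef _ _ 1 f g i.+1 fg) ?subrr // addn1.
    by rewrite !nth_default ?subrr // (leq_trans (size_npoly _)).
  have := congr1 (fun h : {poly F} => h.[alpha]) fgE.
  rewrite hornerC hornerD hornerN fa ga subrr => e0.
  by move: fgE; rewrite -e0 => /eqP; rewrite subr_eq0 => /eqP.
(* Any nonconstant part is possible; the constant term then adjusts the value at [alpha] to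
   [beta]. *)
pose h (r : {poly_k F}) : {poly_k.+1 F} :=
  npolyp k.+1 ('X * (r : {poly F}) + (beta - alpha * (r : {poly F}).[alpha])%:P).
have hE r : h r = 'X * (r : {poly F}) +
    (beta - alpha * (r : {poly F}).[alpha])%:P :> {poly F}.
  rewrite npolypK // (leq_trans (size_polyD _ _)) // geq_max.
  rewrite (leq_trans (size_polyMleq _ _)) ?size_polyX ?ltnS ?size_npoly //=.
  by rewrite (leq_trans (size_polyC_leq1 _)).
rewrite -(card_imset (f := h)) => [|r r' /(congr1 val) /=].
  apply/subset_leq_card/subsetP => _ /imsetP[r _ ->]; rewrite inE hE.
  by rewrite hornerD hornerM hornerX hornerC; apply/eqP; ring.
rewrite !hE => rr; apply/val_inj/polyP => i /=.
by have := congr1 (fun h : {poly F} => h`_i.+1) rr; rewrite !coefD !coefXM !coefC !addr0.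
Qed.

Lemma card_two_stars k alpha beta alpha' beta' : alpha != alpha' ->
  (#|star k.+2 alpha beta :&: star k.+2 alpha' beta'| <= q ^ k)%N.
Proof.
move=> aN; rewrite -card_npoly -(card_in_imset (f := tail_npoly k.+2 k 2)) ?max_card //.
move=> f g; rewrite !inE => /andP[/eqP fa /eqP fa'] /andP[/eqP ga /eqP ga'] fg.
apply/val_inj => /=.
set c0 := (f : {poly F})`_0 - (g : {poly F})`_0.
set c1 := (f : {poly F})`_1 - (g : {poly F})`_1.
have fgE : (f : {poly F}) - g = c0%:P + c1 *: 'X.
  apply/polyP => -[|[|i]]; rewrite coefB coefD coefC coefZ coefX /= ?mulr0 ?mulr1 ?addr0 ?add0r //.
  have [ik|ki] := ltnP i k.
    by rewrite (tail_npoly_coef _ _ 2 f g i.+2 fg) ?subrr // addn2.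
  by rewrite !nth_default ?subrr // (leq_trans (size_npoly _)).
have ev x : (f : {poly F}).[x] = (g : {poly F}).[x] -> c0 + c1 * x = 0.
  move=> e; have := congr1 (fun h : {poly F} => h.[x]) fgE.
  by rewrite !hornerE e subrr => ->.
have e1 := ev alpha (etrans fa (esym ga)).
have e2 := ev alpha' (etrans fa' (esym ga')).
have c1E : c1 = 0.
  have /eqP : c1 * (alpha - alpha') = 0.
    by rewrite -[RHS](subrr 0) -{1}e1 -e2; ring.
  by rewrite mulf_eq0 [alpha - _ == 0]subr_eq0 (negPf aN) orbF => /eqP.
move: e1 fgE; rewrite c1E mul0r addr0 scale0r addr0 => -> /eqP.
by rewrite subr_eq0 => /eqP.
Qed.

Lemma card_star_lead m alpha beta a :
  (#|[set f in star m.+3 alpha beta | ((f : {poly F})`_m.+2 == a)%R]| <= q ^ m.+1)%N.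
Proof.
rewrite -card_npoly -(card_in_imset (f := tail_npoly m.+3 m.+1 1)) ?max_card //.
move=> f g; rewrite !inE => /andP[/eqP fa /eqP fl] /andP[/eqP ga /eqP gl] fg.
apply/val_inj => /=.
have fgE : (f : {poly F}) - g = ((f : {poly F})`_0 - (g : {poly F})`_0)%:P.
  apply/polyP => -[|i]; rewrite coefB coefC //=.
  have [im|] := ltnP i m.+1.
    by rewrite (tail_npoly_coef _ _ 1 f g i.+1 fg) ?subrr // addn1.
  rewrite leq_eqVlt => /orP[/eqP <-|ki]; first by rewrite fl gl subrr.
  by rewrite !nth_default ?subrr // (leq_trans (size_npoly _)).
have := congr1 (fun h : {poly F} => h.[alpha]) fgE.
rewrite hornerC hornerD hornerN fa ga subrr => e0.
by move: fgE; rewrite -e0 => /eqP; rewrite subr_eq0 => /eqP.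
Qed.

(* For each [r] some slope [u] makes
   [beta + u (X - alpha) + (X - alpha)^2 r + a (X^(m+2) - alpha^(m+2))]
   disjoint from [g], since only [q - 1] slopes are excluded. *)
Lemma card_slice_missed m (alpha beta a : F) (S : {set {poly_m.+3 F}}) (g : {poly F}) :
    g.[alpha] != beta ->
    {in S, forall f : {poly_m.+3 F}, [/\ (f : {poly F})`_m.+2 = a, (f : {poly F}).[alpha] = beta
                      & exists x, (f : {poly F}).[x] = g.[x]]} ->
  (#|S| + q ^ m <= q ^ m.+1)%N.
Proof.
move=> ga Sf.
pose b (r : {poly_m F}) : {poly F} := beta%:P + ('X - alpha%:P) ^+ 2 * r
  + a *: ('X^(m.+2) - (alpha ^+ m.+2)%:P).
have free r : exists u, u \notin
    [set (g.[x] - (b r).[x]) / (x - alpha) | x in [set~ alpha]].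
  apply/existsP; rewrite -negb_forall; apply/negP => /forallP all_in.
  have := leq_imset_card (fun x => (g.[x] - (b r).[x]) / (x - alpha)) [set~ alpha].
  rewrite (eq_card (B := F)) ?cardsC1 => [|u]; last exact: all_in.
  by have := card_finRing_gt1 F; case: q => // c _; rewrite ltnn.
pose u r := xchoose (free r).
pose h r : {poly_m.+3 F} := npolyp m.+3 (b r + u r *: ('X - alpha%:P)).
have size_sq (r : {poly_m F}) : (size (('X - alpha%:P) ^+ 2 * (r : {poly F}))%R <= m.+2)%N.
  rewrite (leq_trans (size_polyMleq _ _)) // size_exp_XsubC /=.
  by rewrite !ltnS size_npoly.
have hE r : h r = b r + u r *: ('X - alpha%:P) :> {poly F}.
  rewrite npolypK // /b.
  have lin : (size (u r *: ('X - alpha%:P))%R <= m.+3)%N.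
    by rewrite (leq_trans (size_scale_leq _ _)) // size_XsubC.
  have cst (c : F) : (size (c%:P)%R <= m.+3)%N by rewrite (leq_trans (size_polyC_leq1 _)).
  have top : (size (a *: ('X^(m.+2) - (alpha ^+ m.+2)%:P))%R <= m.+3)%N.
    rewrite (leq_trans (size_scale_leq _ _)) // (leq_trans (size_polyD _ _)) //.
    by rewrite size_polyN size_polyXn geq_max leqnn cst.
  do 3!rewrite (leq_trans (size_polyD _ _)) // geq_max ?lin ?top ?cst //=.
  by rewrite ?andbT ltnW // ltnS size_sq.
have h_star r : h r \in [set f in star m.+3 alpha beta | (f : {poly F})`_m.+2 == a].
  rewrite !inE hE /b; apply/andP; split; apply/eqP.
    rewrite !hornerD hornerM horner_exp !hornerZ !hornerXsubC.
    by rewrite hornerD hornerN hornerXn !hornerC; ring.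
  rewrite !(coefD, coefZ, coefN, coefXn, coefX, coefC) eqxx /=.
  by rewrite nth_default ?size_sq //; ring.
have h_miss r : h r \notin S.
  apply/negP => /Sf[_ ha [x]]; have [->|xa] := eqVneq x alpha.
    by move=> e; move: ga; rewrite -e ha eqxx.
  rewrite hE => hx; have := xchooseP (free r); rewrite -/(u r) => /imsetP[].
  exists x; first by rewrite !inE.
  by rewrite -hx !hornerE; field; rewrite subr_eq0.
have h_inj : injective h.
  move=> r r' /(congr1 val) /=; rewrite !hE => rr.
  have X0 : 'X - alpha%:P != 0 :> {poly F} by rewrite polyXsubC_eq0.
  (* The slope depends on [r], so injectivity needs an argument: cancel one factor [X - alpha], then
     evaluate at [alpha] to see that the slopes agree. *)
  have E : ('X - alpha%:P) * ((r : {poly F}) - r') = (u r' - u r)%:P.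
    apply: (mulfI X0); apply/eqP; rewrite -subr_eq0.
    have -> : ('X - alpha%:P) * (('X - alpha%:P) * ((r : {poly F}) - r')) -
        ('X - alpha%:P) * (u r' - u r)%:P =
      (b r + u r *: ('X - alpha%:P)) - (b r' + u r' *: ('X - alpha%:P)).
      by rewrite /b -!mul_polyC polyCB; ring.
    by rewrite rr subrr.
  have u0 : u r' - u r = 0.
    have := congr1 (fun p : {poly F} => p.[alpha]) E.
    by rewrite hornerM hornerXsubC subrr mul0r hornerC => <-.
  move/eqP: E; rewrite u0 mulf_eq0 (negPf X0) subr_eq0 => /eqP.
  exact: val_inj.
rewrite -{1}card_npoly -(card_imset _ h_inj) -cardsUI.
rewrite (_ : S :&: _ = set0) ?cards0 ?addn0; last first.
  apply/setP => f; rewrite !inE; apply/negP => /andP[fS /imsetP[r _ fE]].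
  by move: fS; rewrite fE (negPf (h_miss r)).
apply: leq_trans (card_star_lead m alpha beta a).
apply/subset_leq_card/subsetP => f; rewrite inE => /orP[fS|/imsetP[r _ ->]] //.
by have [fl fa _] := Sf f fS; rewrite !inE fa fl !eqxx.
Qed.

(** * Induction on the degree *)

Hypothesis q_odd : odd q -> (9 < q)%N.
Hypothesis q_even : ~~ odd q -> (2 < q)%N.

Lemma intersecting_star3 (U : {set {poly_3 F}}) : intersecting U ->
    (q ^ 2 - q ^ 1 < #|U|)%N ->
  exists alpha beta, {in U, forall g : {poly_3 F}, (g : {poly F}).[alpha] = beta}.
Proof.
move=> hU Ubig.
pose h (f : {poly_3 F}) : F * F * F :=
  ((f : {poly F})`_2, (f : {poly F})`_1, (f : {poly F})`_0).
have hE f x : qeval F (h f) x = (f : {poly F}).[x].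
  rewrite (horner_coef_wide _ (size_npoly f)) !big_ord_recl big_ord0 /qeval /=.
  by rewrite /bump /=; ring.
have h_inj : injective h.
  move=> f g [e2 e1 e0]; apply/val_inj/polyP => -[|[|[|i]]] //=.
  by rewrite !nth_default // (leq_trans (size_npoly _)).
have [||x [y star_h]] := quad_star F (h @: U) _ q_odd q_even.
- move=> _ _ /imsetP[f fU ->] /imsetP[g gU ->].
  by have [x fg] := hU f g fU gU; exists x; rewrite !hE.
- by rewrite card_imset // -{2}[q]expn1.
by exists x, y => f fU; rewrite -hE star_h // imset_f.
Qed.

Lemma intersecting_star k (U : {set {poly_k.+3 F}}) : intersecting U ->
    (q ^ k.+2 - q ^ k.+1 < #|U|)%N ->
  exists alpha beta, {in U, forall g : {poly_k.+3 F}, (g : {poly F}).[alpha] = beta}.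
Proof.
elim: k U => [|k IHk] U hU Ubig; first exact: intersecting_star3.
pose slice a := [set f in U | (f : {poly F})`_k.+3 == a].
have [a slice_big] : exists a, (q ^ k.+2 - q ^ k.+1 < #|slice a|)%N.
  apply/existsP; apply: contraLR Ubig => /existsPn small.
  have -> : (#|U| = \sum_a #|slice a|)%N.
    rewrite -sum1_card (partition_big (fun f : {poly_k.+4 F} => (f : {poly F})`_k.+3) xpredT) //=.
    by apply: eq_bigr => a _; rewrite -sum1_card; apply: eq_bigl => f; rewrite inE.
  rewrite -leqNgt !(expnS q k.+2) (expnS q k.+1) -mulnBr -sum_nat_const.
  by apply: leq_sum => a _; have := small a; rewrite -leqNgt expnS.
(* Removing the leading term common to a slice preserves agreements between its members and lowers
   the degree bound. *)
pose trunc (f : {poly_k.+4 F}) : {poly_k.+3 F} := npolyp k.+3 f.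
have truncE f : f \in slice a ->
    (f : {poly F}) = (trunc f : {poly F}) + a *: 'X^(k.+3).
  rewrite inE => /andP[_ /eqP fa]; apply/polyP => i.
  rewrite coefD coefZ coefXn coef_npolyp.
  case: ltngtP => [ik|ki|->]; rewrite ?mulr0 ?addr0 ?mulr1 ?add0r //.
  by rewrite nth_default // (leq_trans (size_npoly _)).
have truncH f x : f \in slice a ->
    (f : {poly F}).[x] = (trunc f : {poly F}).[x] + a * x ^+ k.+3.
  by move=> /truncE {1}->; rewrite !hornerE.
have sliceU f : f \in slice a -> f \in U by rewrite inE => /andP[].
have [||alpha [beta star_t]] := IHk (trunc @: slice a).
- move=> _ _ /imsetP[f fs ->] /imsetP[g gs ->].
  have [x] := hU f g (sliceU f fs) (sliceU g gs).
  by rewrite !truncH // => /addIr; exists x.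
- rewrite card_in_imset // => f g fs gs fg; apply/val_inj => /=.
  by rewrite (truncE f fs) (truncE g gs) fg.
exists alpha, (beta + a * alpha ^+ k.+3) => g gU.
(* A member missing the common point of the slice would force the slice down to [q^(k+2) - q^(k+1)]
   elements, by [card_slice_missed]. *)
apply/eqP; apply: contraLR slice_big => galpha; rewrite -leqNgt.
have := card_slice_missed k.+1 alpha (beta + a * alpha ^+ k.+3) a (slice a) g galpha.
rewrite leq_subRL ?leq_pexp2l //; last by apply/card_gt0P; exists 0.
rewrite addnC; apply => f fs; split.
- by move: fs; rewrite inE => /andP[_ /eqP].
- by rewrite truncH // star_t ?imset_f.
exact: hU (sliceU f fs) gU.
Qed.
End Polynomials.

(* F is a finite field with q = #|F| elements; {poly_k.+1 F} is the finite
   type of polynomials of degree at most k. *)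
Theorem theorem2 (F : finFieldType) (k : nat)
  (hq_odd : odd #|F| -> (9 < #|F|)%N)
  (hq_even : ~~ odd #|F| -> (2 < #|F|)%N)
  (hk : (1 < k)%N)
  (U : {set {poly_k.+1 F}})
  (hU : intersecting U)
  (hsize : (#|F| ^ k - #|F| ^ k.-1 < #|U|)%N) :
  (exists alpha beta : F, forall g : {poly_k.+1 F}, g \in U ->
      (g : {poly F}).[alpha] = beta) /\
  (exists! V : {set {poly_k.+1 F}},
      [/\ U \subset V, intersecting V & #|V| = (#|F| ^ k)%N]).
Proof.
case: k hk U hU hsize => [|[|k]] // _ U hU hsize.
have [alpha [beta Ustar]] := intersecting_star F hq_odd hq_even k U hU hsize.
split; first by exists alpha, beta.
have q1 := card_finRing_gt1 F; have q0 := ltnW q1.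
exists (star F k.+3 alpha beta); split.
  split; last exact: card_star.
    by apply/subsetP => f /Ustar fa; rewrite inE fa.
  move=> f g; rewrite !inE => /eqP fa /eqP ga.
  by exists alpha; rewrite fa.
move=> V [UV hV cV].
have [|alpha' [beta' Vstar]] := intersecting_star F hq_odd hq_even k V hV.
  by rewrite cV ltn_subrL !expn_gt0 q0.
(* [V] is large enough to lie in a star itself, and it has the same size as that star. *)
have VE : V = star F k.+3 alpha' beta'.
  apply/eqP; rewrite eqEcard card_star cV leqnn andbT.
  by apply/subsetP => f /Vstar fa; rewrite inE fa.
have [aE|aN] := eqVneq alpha alpha'.
  have /card_gt0P[f fU] : (0 < #|U|)%N by apply: leq_ltn_trans hsize.
  by rewrite VE -aE -(Vstar f (subsetP UV f fU)) -aE (Ustar f fU).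
(* With different abscissas, [U] would lie in the intersection of two stars, which is too small
   because [q >= 2]. *)
have : (#|U| <= #|F| ^ k.+1)%N.
  apply: leq_trans (card_two_stars F k.+1 alpha beta alpha' beta' aN).
  apply/subset_leq_card/subsetP => f fU; rewrite !inE (Ustar f fU) eqxx.
  by rewrite (Vstar f (subsetP UV f fU)) /=.
move/(leq_trans hsize); rewrite ltn_subLR ?leq_pexp2l //= => lt.
have : (2 * #|F| ^ k.+1 <= #|F| ^ k.+2)%N by rewrite [leqRHS]expnS leq_mul2r q1 orbT.
by rewrite mul2n -addnn leqNgt lt.
Qed.
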